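(* Let $p_1,p_2$ be transcendental periods with $\deg(p_1)\ne\deg(p_2)$. Then both $p_1/p_2$ and $p_1+p_2$ are transcendental numbers.
   Context: Let $\overline{\mathbb{Q}}$ denote the field of algebraic numbers. For $n\ge 1$, an admissible domain in $\mathbb{R}^n$ is a subset of $\mathbb{R}^n$ which is a finite union of sets of the form $\{x\in\mathbb{R}^n : P_1(x)\,\square_1\, 0,\dots,P_r(x)\,\square_r\, 0\}$, where each $P_i$ is a polynomial with real algebraic coefficients and each $\square_i\in\{\ge,>\}$, and which has finite Lebesgue measure $\mathrm{vol}_n$. A real number $p$ is a real period if $p=\mathrm{vol}_n(\Sigma_1)-\mathrm{vol}_n(\Sigma_2)$ for some $n\ge1$ and admissible domains $\Sigma_1,\Sigma_2\subseteq\mathbb{R}^n$; a complex number is a period if its real and imaginary parts are real periods. The degree is defined as follows: $\deg(0)=0$; for a nonzero real period $p$, $\deg(p)$ is the least $n\ge 1$ such that $p=\mathrm{vol}_n(\Sigma_1)-\mathrm{vol}_n(\Sigma_2)$ with $\Sigma_1,\Sigma_2$ admissible domains in $\mathbb{R}^n$; for a complex period $p=a+ib$ ($a,b$ real), $\deg(p)=\max(\deg(a),\deg(b))$; for a complex number that is not a period, $\deg(p)=\infty$, with $\infty$ larger than every integer. *)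

(* Defs.v *)
From Stdlib Require List.
From HB Require Import structures.
From mathcomp Require Import all_boot all_order all_algebra.
From mathcomp Require Import all_classical all_reals all_analysis.
From mathcomp Require complex.
Import complex.ComplexField.
From mathcomp Require mpoly.

Set Implicit Arguments.
Unset Strict Implicit.
Unset Printing Implicit Defensive.

Import Order.TTheory GRing.Theory Num.Theory.
Local Open Scope classical_set_scope.
Local Open Scope ring_scope.

Section Periods.
Variable R : realType.

Definition algebraic (F : numFieldType) (x : F) : Prop :=
  exists p : {poly rat}, p != 0 /\ root (map_poly (@ratr F) p) x.

Definition transcendental (F : numFieldType) (x : F) : Prop :=
  ~ algebraic x.

Definition ext_pt (n : nat) (y : 'I_n -> R) (t : R) : 'I_n.+1 -> R :=
  fun i => match unlift ord_max i with Some j => y j | None => t end.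

(* n-dimensional Lebesgue volume, as the iterated (Tonelli) integral of
   the indicator function with respect to the Lebesgue measure on R. *)
Fixpoint vol (n : nat) : set ('I_n -> R) -> \bar R :=
  match n return set ('I_n -> R) -> \bar R with
  | 0 => fun A => if `[< A (fun _ => 0) >] then 1%E else 0%E
  | m.+1 => fun A =>
      (\int[@lebesgue_measure R]_(t in [set: R])
          vol [set y : 'I_m -> R | A (ext_pt y t)])%E
  end.

Definition alg_coef_poly (n : nat) (P : mpoly.mpoly n R) : Prop :=
  forall m : mpoly.multinom n, algebraic (mpoly.mcoeff m P).

Definition basic_set (n : nat) (L : seq (mpoly.mpoly n R * bool))
  : set ('I_n -> R) :=
  [set x | forall c, Stdlib.Lists.List.In c L ->
     if c.2 then 0 < mpoly.meval x c.1 else 0 <= mpoly.meval x c.1].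

Definition admissible (n : nat) (S : set ('I_n -> R)) : Prop :=
  exists LL : seq (seq (mpoly.mpoly n R * bool)),
    (forall L c, Stdlib.Lists.List.In L LL -> Stdlib.Lists.List.In c L -> alg_coef_poly c.1) /\
    S = (fun x => exists2 L, Stdlib.Lists.List.In L LL & basic_set L x) /\
    (vol S < +oo)%E.

Definition period_in_dim (n : nat) (a : R) : Prop :=
  exists S1 S2 : set ('I_n -> R), admissible S1 /\ admissible S2 /\
    (vol S1 - vol S2)%E = a%:E.

Definition real_period (a : R) : Prop :=
  exists n, (0 < n)%N /\ period_in_dim n a.

Definition period (z : complex.complex R) : Prop :=
  real_period (complex.Re z) /\ real_period (complex.Im z).

(* degree; None stands for infinity *)
Definition real_deg (a : R) : option nat :=
  if a == 0 then Some 0%N else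
  match pselect (exists n, (fun k => `[< (0 < k)%N /\ period_in_dim k a >]) n) with
  | left H => Some (ex_minn H)
  | right _ => None
  end.

Definition deg (z : complex.complex R) : option nat :=
  match real_deg (complex.Re z), real_deg (complex.Im z) with
  | Some a, Some b => Some (maxn a b)
  | _, _ => None
  end.

End Periods.

(* Main.v *)
(* For n >= 1 let V_n be the set of differences of volumes of admissible domains
   in R^n. It is a vector space over the real algebraic numbers, it contains
   them, and it is included in V_(n+1) because A x [0, 1] has the volume of A.
   Hence the degree does not change under z |-> a z + b with a <> 0 and b
   algebraic, and if p1 / p2 or p1 + p2 were algebraic then p2 would be the
   image of p1 under such a map.

   The only delicate point is that V_n is closed under addition, since admissible
   domains may be unbounded and two of them have to be packed disjointly into
   R^n. In dimension 1 a semialgebraic set of finite length is bounded, and a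
   translation suffices. In dimension n >= 2 volume-preserving piecewise affine
   maps of the last two coordinates fold each domain into a quadrant, and two
   shears then move the domains to the two sides of the diagonal. *)
Require Import Defs.
From HB Require Import structures.
From mathcomp Require Import all_boot all_order all_algebra.
From mathcomp Require Import -(notations) mpoly.
From mathcomp Require Import all_classical all_reals all_analysis.
From mathcomp Require Import measurable_realfun.
From mathcomp Require complex.
From mathcomp Require polyrcf.
From mathcomp Require Import lra.
Import complex.ComplexField.
Import Order.TTheory GRing.Theory Num.Theory.
Local Open Scope ring_scope.
Set Implicit Arguments.
Unset Strict Implicit.
Unset Printing Implicit Defensive.


(** * Measurability in R^n for the product sigma-algebra *)

Section Space.
Local Open Scope classical_set_scope.
Variable R : realType.

(* An alias of ['I_n -> R] carrying the product sigma-algebra. *)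
Definition euclid (n : nat) : Type := 'I_n -> R.
Variable n : nat.

Definition coord (i : 'I_n) (x : euclid n) : R := x i.

HB.instance Definition _ := gen_eqMixin (euclid n).
HB.instance Definition _ := gen_choiceMixin (euclid n).
HB.instance Definition _ := isPointed.Build (euclid n) (fun=> 0).

Let euclid_set0 : g_sigma_preimage coord set0.
Proof. exact: sigma_algebra0. Qed.

Let euclid_setC A : g_sigma_preimage coord A -> g_sigma_preimage coord (~` A).
Proof. exact: sigma_algebraC. Qed.

Let euclid_bigcup (F : _^nat) : (forall i, g_sigma_preimage coord (F i)) ->
  g_sigma_preimage coord (\bigcup_i (F i)).
Proof. exact: sigma_algebra_bigcup. Qed.

HB.instance Definition _ := @isMeasurable.Build
  (measure_tuple_display default_measure_display)
  (euclid n) (g_sigma_preimage coord) euclid_set0 euclid_setC euclid_bigcup.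

Lemma measurable_coord (i : 'I_n) :
  measurable_fun [set: euclid n] (fun x : euclid n => x i).
Proof.
move=> _ Y mY; rewrite setTI; apply: sub_sigma_algebra => /=.
rewrite -bigcup_seq/=; exists i => /=; first by rewrite mem_index_enum.
by exists Y => //; rewrite setTI.
Qed.

Lemma measurable_fun_coordP d (T : measurableType d) (f : T -> euclid n) :
  (forall i, measurable_fun [set: T] (fun x => f x i)) ->
  measurable_fun [set: T] f.
Proof.
move=> mf.
suff H : preimage_set_system [set: T] f (g_sigma_preimage coord) `<=` measurable.
  by move=> _ A mA; apply: H; exists A.
rewrite -(g_sigma_preimage_comp coord f).
apply: smallest_sub; first exact: sigma_algebra_measurable.
rewrite -bigcup_seq; apply: bigcup_sub => i _ A [B mB <-]; exact: mf.
Qed.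

End Space.

(** * The iterated integral as a measure, and its behaviour under affine maps *)

Section Volume.
Local Open Scope classical_set_scope.
Local Open Scope ereal_scope.
Variable R : realType.
Local Notation leb := (@lebesgue_measure R).

Lemma ext_pt_max n (y : 'I_n -> R) t : ext_pt y t ord_max = t.
Proof. by rewrite /ext_pt unlift_none. Qed.

Lemma ext_pt_lift n (y : 'I_n -> R) t i : ext_pt y t (lift ord_max i) = y i.
Proof. by rewrite /ext_pt liftK. Qed.

Definition init_pt n (x : 'I_n.+1 -> R) : 'I_n -> R := fun i => x (lift ord_max i).

Lemma init_ext_pt n (y : 'I_n -> R) t : init_pt (ext_pt y t) = y.
Proof. by apply/funext => i; rewrite /init_pt ext_pt_lift. Qed.

Lemma measurable_ext_pt d (T : measurableType d) n (f : T -> euclid R n)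
    (g : T -> R) :
  measurable_fun [set: T] f -> measurable_fun [set: T] g ->
  measurable_fun [set: T] (fun x => ext_pt (f x) (g x) : euclid R n.+1).
Proof.
move=> mf mg; apply: measurable_fun_coordP => i.
rewrite /ext_pt; case: unliftP => [j|] _ //.
exact: (measurableT_comp (measurable_coord j) mf).
Qed.

Lemma measurable_init_pt n :
  measurable_fun [set: euclid R n.+1] (@init_pt n : euclid R n.+1 -> euclid R n).
Proof. by apply: measurable_fun_coordP => i; exact: measurable_coord. Qed.

Lemma volS n (A : set ('I_n.+1 -> R)) :
  vol A = \int[leb]_t vol [set y | A (ext_pt y t)].
Proof. by []. Qed.

Lemma vol_ge0 n (A : set ('I_n -> R)) : 0 <= vol A.
Proof.
elim: n A => [|n ih] A; first by rewrite /=; case: ifP.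
by apply: integral_ge0 => t _; exact: ih.
Qed.

Section VolumeStep.
Variables (n : nat) (mu : {sigma_finite_measure set (euclid R n) -> \bar R}).
Let phi (z : measurableTypeR R * euclid R n) : euclid R n.+1 := ext_pt z.2 z.1.
Let mphi : measurable_fun setT phi.
Proof. exact: measurable_ext_pt. Qed.

(** The product measure carried to R^(n+1) along [phi], which appends the first component as last
    coordinate. This turns one step of the iterated integral into a genuine measure. *)
Let nu := pushforward (leb \x mu)%E phi.

Let nu0 : nu set0 = 0. Proof. exact: measure0. Qed.

Let nu_ge0 A : 0 <= nu A. Proof. exact: measure_ge0. Qed.

Let nu_sigma_additive : semi_sigma_additive nu.
Proof. exact: measure_semi_sigma_additive. Qed.

HB.instance Definition _ := isMeasure.Build _ _ _ nu nu0 nu_ge0 nu_sigma_additive.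

Let nu_sigma_finite : sigma_finite setT nu.
Proof.
have /sigma_finiteP[F [TF ndF Foo]] := sigma_finiteT leb.
have /sigma_finiteP[G [TG ndG Goo]] := sigma_finiteT mu.
(* Products of two increasing exhaustions; monotonicity allows the common index [maxn i j]. *)
exists (fun k => [set x | F k (x ord_max)] `&` [set x | G k (init_pt x)]).
  apply/esym; rewrite -subTset => x _.
  have [i _ Fi] : (\bigcup_i F i) (x ord_max) by rewrite -TF.
  have [j _ Gj] : (\bigcup_i G i) (init_pt x) by rewrite -TG.
  exists (maxn i j) => //; split => /=.
    by move: Fi; exact/subsetPset/ndF/leq_maxl.
  by move: Gj; exact/subsetPset/ndG/leq_maxr.
move=> k; have [mF Fk] := Foo k; have [mG Gk] := Goo k; split.
  apply: measurableI; rewrite -[X in measurable X]setTI.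
    exact: (measurable_coord ord_max).
  exact: measurable_init_pt.
rewrite /nu /pushforward (_ : _ @^-1` _ = F k `*` G k).
  by rewrite product_measure1E// lte_mul_pinfty// ge0_fin_numE.
by apply/seteqP; split=> -[t y]; rewrite /phi /= ext_pt_max init_ext_pt.
Qed.

HB.instance Definition _ := Measure_isSigmaFinite.Build _ _ _ nu nu_sigma_finite.

Definition volume_step : {sigma_finite_measure set (euclid R n.+1) -> \bar R} := nu.

Lemma volume_stepE A : volume_step A = \int[leb]_t mu [set y | A (ext_pt y t)].
Proof.
rewrite /volume_step /= /nu /pushforward /product_measure1.
by apply: eq_integral => t _ /=; rewrite xsectionE.
Qed.

End VolumeStep.

(** [vol] is only a function on sets; this bundled copy gives access to additivity, monotonicity and
    Tonelli. In dimension 0 it is the Dirac mass at the unique point. *)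
Fixpoint volume n : {sigma_finite_measure set (euclid R n) -> \bar R} :=
  match n with
  | 0 => @dirac _ (euclid R 0) (fun=> 0%R) R
  | m.+1 => volume_step (volume m)
  end.

Lemma volumeE n A : volume n A = @vol R n A.
Proof.
elim: n A => [|n ih] A.
  rewrite /= /dirac indicE.
  case: ifPn => /asboolP h; first by rewrite mem_set.
  by rewrite memNset.
rewrite volS [LHS]volume_stepE; apply: eq_integral => t _; exact: ih.
Qed.

Lemma volU n (A B : set (euclid R n)) : measurable A -> measurable B ->
  A `&` B = set0 -> vol (A `|` B) = vol A + vol B.
Proof. by move=> mA mB AB; rewrite -!volumeE measureU. Qed.

Lemma vol_split n (P A : set (euclid R n)) : measurable P -> measurable A ->
  vol A = vol (A `&` P) + vol (A `&` ~` P).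
Proof.
move=> mP mA; rewrite -volU.
- by rewrite -setIUr setUv setIT.
- exact: measurableI.
- by apply: measurableI => //; exact: measurableC.
- by rewrite setIACA setICr setI0.
Qed.

(** The fibre over [x] is the section at [x] of the preimage of [A]. Taking [T] to be R or R x R
    covers slices by one or by two coordinates. *)
Lemma measurable_vol_fiber d (T : measurableType d) n m
    (f : T * euclid R n -> euclid R m) (A : set (euclid R m)) :
  measurable_fun setT f -> measurable A ->
  measurable_fun setT (fun x => vol [set y | A (f (x, y))]).
Proof.
move=> mf mA.
have mfA : measurable (f @^-1` A) by rewrite -[X in measurable X]setTI; exact: mf.
have := measurable_fun_xsection (volume n) mfA.
congr measurable_fun; apply/funext => x /=.
by rewrite -volumeE xsectionE.
Qed.

Lemma measurable_affine (a b : R) :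
  measurable_fun [set: R] (fun t : R => a * t + b)%R.
Proof. by apply: measurable_funD => //; exact: measurable_funM. Qed.

(** By uniqueness of Lebesgue measure, it suffices that |a| times its pushforward under t -> a t + b
    gives half-open intervals their length. *)
Lemma lebesgue_measure_affine (a b : R) (A : set R) : a != 0%R -> measurable A ->
  leb A = `|a|%:E * leb [set t | A (a * t + b)%R].
Proof.
move=> a0 mA.
pose aff (t : measurableTypeR R) : measurableTypeR R := (a * t + b)%R.
have maff : measurable_fun setT aff by exact: measurable_affine.
pose push : {measure set (measurableTypeR R) -> \bar R} :=
  measure_function_pushforward__canonical__measure_function_Measure leb maff.
pose r : {nonneg R} := NngNum (normr_ge0 a).
suff -> : leb A = mscale r push A by [].
apply: lebesgue_measure_unique mA => _ [[x y]] _ <-.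
rewrite lebesgue_measure_itv /=.
rewrite -[mscale _ _ _]/(`|a|%:E * leb (aff @^-1` [set` `]x, y]%R])).
(* The preimage of ]x, y] is open on the left if a > 0, and on the right if a < 0. *)
have [a_gt0|a_lt0|/eqP] := ltgtP 0%R a; last by rewrite eq_sym (negbTE a0).
- rewrite (_ : aff @^-1` _ = [set` `](x - b) / a, (y - b) / a]%R]); last first.
    apply/seteqP; split => t; rewrite /aff /= !in_itv /=;
    by rewrite ltr_pdivrMr // ler_pdivlMr // ltrBlDr lerBrDr [(t * a)%R]mulrC.
  rewrite lebesgue_measure_itv /= !lte_fin ltr_pM2r ?invr_gt0// ltrD2r.
  case: ifP => _; last by rewrite mule0.
  by rewrite -!EFinB -EFinM gtr0_norm // -mulrBl mulrC divfK // opprB addrA subrK.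
- rewrite (_ : aff @^-1` _ = [set` `[(y - b) / a, (x - b) / a[%R]); last first.
    apply/seteqP; split => t; rewrite /aff /= !in_itv /=;
    by rewrite ltr_ndivlMr // ler_ndivrMr // ltrBlDr lerBrDr [(t * a)%R]mulrC andbC.
  rewrite lebesgue_measure_itv /= !lte_fin ltr_nM2r ?invr_lt0// ltrD2r.
  case: ifP => _; last by rewrite mule0.
  rewrite -!EFinB -EFinM ltr0_norm // -mulrBl mulNr mulrC divfK //; congr EFin.
  lra.
Qed.

Lemma integral_affine (a b : R) (f : R -> \bar R) : a != 0%R ->
  measurable_fun setT f -> (forall t, 0 <= f t) ->
  \int[leb]_t f t = `|a|%:E * \int[leb]_t f (a * t + b)%R.
Proof.
move=> a0 mf f0.
pose aff (t : measurableTypeR R) : measurableTypeR R := (a * t + b)%R.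
have maff : measurable_fun setT aff by exact: measurable_affine.
pose push : {measure set (measurableTypeR R) -> \bar R} :=
  measure_function_pushforward__canonical__measure_function_Measure leb maff.
pose r : {nonneg R} := NngNum (normr_ge0 a).
rewrite (eq_measure_integral (mscale r push)); last first.
  by move=> A mA _; exact: lebesgue_measure_affine.
rewrite ge0_integral_mscale //.
by rewrite [X in _ * X](ge0_integral_pushforward maff) // preimage_setT.
Qed.

(** This map and the next two act on sets by preimage, so the set obtained is the image under the
    inverse map. With y and t the last two coordinates, [shear_last] is (y, t) -> (y - t, t), and
    its preimages are images under (y, t) -> (y + t, t). *)
Definition affine_last n (a b : R) (x : euclid R n.+1) : euclid R n.+1 :=
  ext_pt (init_pt x) (a * x ord_max + b)%R.

Definition swap_last n (x : euclid R n.+2) : euclid R n.+2 :=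
  ext_pt (ext_pt (init_pt (init_pt x)) (x ord_max)) (init_pt x ord_max).

Definition shear_last n (x : euclid R n.+2) : euclid R n.+2 :=
  ext_pt (ext_pt (init_pt (init_pt x)) (init_pt x ord_max - x ord_max)%R)
         (x ord_max).

Lemma measurable_slice n (A : set (euclid R n.+1)) (t : R) : measurable A ->
  measurable [set y : euclid R n | A (ext_pt y t)].
Proof.
move=> mA; rewrite -[X in measurable X]setTI.
exact: (measurable_ext_pt (@measurable_id _ _ _) (measurable_cst t)).
Qed.

Lemma measurable_vol_slice n (A : set (euclid R n.+1)) : measurable A ->
  measurable_fun [set: R] (fun t => vol [set y | A (ext_pt y t)]).
Proof.
apply: (measurable_vol_fiber (f := fun z : R * euclid R n => ext_pt z.2 z.1)).
exact: measurable_ext_pt.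
Qed.

Lemma vol_affine n (a b : R) (A : set (euclid R n.+1)) : a != 0%R ->
  measurable A -> vol A = `|a|%:E * vol (affine_last a b @^-1` A).
Proof.
move=> a0 mA; rewrite !volS (integral_affine b a0).
- congr (_ * _); apply: eq_integral => t _; congr vol; apply/funext => y.
  by rewrite /= /affine_last ext_pt_max init_ext_pt.
- exact: measurable_vol_slice.
- by move=> t; exact: vol_ge0.
Qed.

(** Tonelli for the two outermost integrals, applied to the volume of the double slices. *)
Lemma vol_swap n (A : set (euclid R n.+2)) : measurable A ->
  vol (@swap_last n @^-1` A) = vol A.
Proof.
move=> mA; rewrite 2!volS.
under eq_integral do rewrite volS.
under [RHS]eq_integral do rewrite volS.
pose f (z : R * R) := vol [set y : euclid R n | A (ext_pt (ext_pt y z.2) z.1)].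
rewrite [RHS](@fubini_tonelli _ _ _ _ _ leb leb f).
- apply: eq_integral => y _; apply: eq_integral => t _; congr vol.
  by apply/funext => z; rewrite /= /swap_last !(ext_pt_max, init_ext_pt).
- apply: (measurable_vol_fiber
    (f := fun z : R * R * euclid R n => ext_pt (ext_pt z.2 z.1.2) z.1.1)) => //.
  apply: measurable_ext_pt; last exact: measurableT_comp.
  by apply: measurable_ext_pt => //; exact: measurableT_comp.
- by move=> z; exact: vol_ge0.
Qed.

(** On the slice at height t, the shear is the translation of the preceding coordinate by -t. *)
Lemma vol_shear n (A : set (euclid R n.+2)) : measurable A ->
  vol (@shear_last n @^-1` A) = vol A.
Proof.
move=> mA; rewrite 2!volS; apply: eq_integral => t _.
rewrite [RHS]volS (integral_affine (- t) (oner_neq0 R)).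
- rewrite normr1 mul1e volS; apply: eq_integral => y _; congr vol.
  by apply/funext => z; rewrite /= /shear_last !(ext_pt_max, init_ext_pt) mul1r.
- by apply: measurable_vol_slice; exact: measurable_slice.
- by move=> y; exact: vol_ge0.
Qed.

End Volume.

(** * Field operations on algebraic numbers *)

Section Algebraic.
Variable F : numFieldType.
Implicit Types x y : F.

Lemma algebraicE x : algebraic x <-> algebraicOver (@ratr F) x.
Proof.
by split=> [[p [p0 px]]|[p p0 px]]; exists p.
Qed.

Lemma algD x y : algebraic x -> algebraic y -> algebraic (x + y).
Proof. by rewrite !algebraicE; exact: algebraic_add. Qed.

Lemma algM x y : algebraic x -> algebraic y -> algebraic (x * y).
Proof. by rewrite !algebraicE; exact: algebraic_mul. Qed.

Lemma algN x : algebraic x -> algebraic (- x).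
Proof. by rewrite !algebraicE; exact: algebraic_opp. Qed.

Lemma algV x : algebraic x -> algebraic x^-1.
Proof. by rewrite !algebraicE; exact: algebraic_inv. Qed.

Lemma alg_nat n : algebraic (n%:R : F).
Proof. by rewrite algebraicE -(ratr_nat F); exact: algebraic_id. Qed.

Lemma alg0 : algebraic (0 : F). Proof. exact: (alg_nat 0). Qed.

Lemma alg1 : algebraic (1 : F). Proof. exact: (alg_nat 1). Qed.

Lemma algN1 : algebraic (-1 : F). Proof. by apply: algN; exact: alg1. Qed.

End Algebraic.

(** * Polynomials with algebraic coefficients *)

Section AlgebraicPolynomials.
Variables (R : realType).
Implicit Types (n : nat).

Lemma alg_coef_const n (c : R) : algebraic c -> alg_coef_poly (mpolyC n c).
Proof. by move=> ac m; rewrite mcoeffC; apply: algM => //; exact: alg_nat. Qed.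

Lemma alg_coef_var n (i : 'I_n) : alg_coef_poly (mpolyX R (mnm1 i)).
Proof. by move=> m; rewrite mcoeffX; exact: alg_nat. Qed.

Lemma alg_coefD n (p q : mpoly n R) :
  alg_coef_poly p -> alg_coef_poly q -> alg_coef_poly (p + q).
Proof. by move=> ap aq m; rewrite mcoeffD; exact: algD. Qed.

Lemma alg_coefN n (p : mpoly n R) : alg_coef_poly p -> alg_coef_poly (- p).
Proof. by move=> ap m; rewrite mcoeffN; exact: algN. Qed.

Lemma alg_coefB n (p q : mpoly n R) :
  alg_coef_poly p -> alg_coef_poly q -> alg_coef_poly (p - q).
Proof. by move=> ap aq; apply: alg_coefD => //; exact: alg_coefN. Qed.

Lemma alg_coefM n (p q : mpoly n R) :
  alg_coef_poly p -> alg_coef_poly q -> alg_coef_poly (p * q).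
Proof.
move=> ap aq m; rewrite mcoeffM; apply: (big_ind (@algebraic R)).
- exact: alg0.
- exact: algD.
- by move=> k _; exact: algM.
Qed.

Lemma alg_coef_comp m n (lq : m.-tuple (mpoly n R)) (p : mpoly m R) :
  alg_coef_poly p -> (forall i, alg_coef_poly (tnth lq i)) ->
  alg_coef_poly (comp_mpoly lq p).
Proof.
move=> ap aq; rewrite comp_mpolyE; apply: (big_ind (@alg_coef_poly R n)).
- by rewrite -mpolyC0; apply: alg_coef_const; exact: alg0.
- exact: alg_coefD.
move=> k _; rewrite -mul_mpolyC; apply: alg_coefM; first exact: alg_coef_const.
have a1 : alg_coef_poly (1 : mpoly n R).
  by rewrite -mpolyC1; apply: alg_coef_const; exact: alg1.
apply: (big_ind (@alg_coef_poly R n)) => //; first exact: alg_coefM.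
move=> i _; elim: (k i) => [|e ih]; first by rewrite expr0.
by rewrite exprS; exact: alg_coefM.
Qed.

End AlgebraicPolynomials.

(** * Semialgebraic sets: stability and measurability *)

Section Semialgebraic.
Local Open Scope classical_set_scope.
Variable R : realType.
Implicit Types n : nat.

(** Admissibility with the volume bound split off, so that geometric constructions and volume
    computations can be handled separately. *)
Definition semialg n (S : set ('I_n -> R)) : Prop :=
  exists LL : seq (seq (mpoly n R * bool)),
    (forall L c, List.In L LL -> List.In c L -> alg_coef_poly c.1) /\
    S = (fun x => exists2 L, List.In L LL & basic_set L x).

Lemma admissibleE n (S : set ('I_n -> R)) :
  admissible S <-> semialg S /\ (vol S < +oo)%E.
Proof.
by split=> [[LL [aLL [SE fS]]]|[[LL [aLL SE]] fS]]; [split => //; exists LL|exists LL].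
Qed.

Lemma semialg_basic n (P : mpoly n R) (b : bool) : alg_coef_poly P ->
  semialg [set x | if b then 0 < meval x P else 0 <= meval x P].
Proof.
move=> aP; exists [:: [:: (P, b)]]; split.
  by move=> L c /= [<-|//] /= [<-|//].
apply/funext => x; apply/propext; split => /=.
  by move=> Px; exists [:: (P, b)]; [left|move=> c /= [<-|//]].
by move=> [L [<-|//]] /(_ (P, b)); apply; left.
Qed.

Lemma semialg_gt0 n (P : mpoly n R) : alg_coef_poly P ->
  semialg [set x | 0 < meval x P].
Proof. exact: (@semialg_basic n P true). Qed.

Lemma semialg_ge0 n (P : mpoly n R) : alg_coef_poly P ->
  semialg [set x | 0 <= meval x P].
Proof. exact: (@semialg_basic n P false). Qed.

Lemma semialg0 n : @semialg n set0.
Proof.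
by exists [::]; split => //; apply/seteqP; split => x // [].
Qed.

Lemma semialgU n (A B : set ('I_n -> R)) : semialg A -> semialg B ->
  semialg (A `|` B).
Proof.
move=> [K [aK ->]] [L [aL ->]]; exists (K ++ L)%SEQ; split.
  by move=> M c /List.in_app_iff[/aK|/aL]; exact.
apply/funext => x; apply/propext; split.
  by move=> [[M iM Mx]|[M iM Mx]]; exists M => //; apply/List.in_app_iff; [left|right].
by move=> [M /List.in_app_iff[iM|iM] Mx]; [left|right]; exists M.
Qed.

(** Intersection distributes over the two unions: each pair of systems contributes its
    concatenation. *)
Lemma semialgI n (A B : set ('I_n -> R)) : semialg A -> semialg B ->
  semialg (A `&` B).
Proof.
move=> [K [aK ->]] [L [aL ->]].
exists (List.map (fun p => p.1 ++ p.2)%SEQ (List.list_prod K L)); split.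
  move=> M c /List.in_map_iff[[k l] /= [<- /List.in_prod_iff[iK iL]]].
  by case/List.in_app_iff; [exact: aK|exact: aL].
apply/funext => x; apply/propext; split.
  move=> [[k ik kx] [l il lx]]; exists (k ++ l)%SEQ.
    by apply/List.in_map_iff; exists (k, l); split => //; apply/List.in_prod_iff.
  by move=> c /List.in_app_iff[/kx|/lx].
move=> [_ /List.in_map_iff[[k l] /= [<- /List.in_prod_iff[ik il]]] klx].
by split; [exists k|exists l] => // c ic; apply: klx; apply/List.in_app_iff; [left|right].
Qed.

(** Substitute the polynomials [f] into those defining [A]. Stability under each coordinate map
    below is an instance. *)
Lemma semialg_preimage m n (f : 'I_m -> mpoly n R) (A : set ('I_m -> R)) :
  (forall i, alg_coef_poly (f i)) -> semialg A ->
  semialg [set x | A (fun i => meval x (f i))].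
Proof.
move=> af [LL [aLL ->]].
pose g (c : mpoly m R * bool) := (comp_mpoly [tuple f i | i < m] c.1, c.2).
have gE x c : meval x (g c).1 = meval (fun i => meval x (f i)) c.1.
  by rewrite comp_mpoly_meval; apply: meval_eq => i; rewrite tnth_mktuple.
exists (List.map (List.map g) LL); split.
  move=> _ _ /List.in_map_iff[L [<- iL]] /List.in_map_iff[c [<- ic]].
  apply: alg_coef_comp; first exact: aLL iL ic.
  by move=> i; rewrite tnth_mktuple.
apply/funext => x; apply/propext; split => /=.
  move=> [L iL Lx]; exists (List.map g L); first by apply/List.in_map_iff; exists L.
  by move=> _ /List.in_map_iff[c [<- /Lx]]; rewrite gE.
move=> [_ /List.in_map_iff[L [<- iL]] Lx]; exists L => // c ic.
by rewrite -gE; apply: (Lx (g c)); apply/List.in_map_iff; exists c.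
Qed.

Lemma measurable_meval n (P : mpoly n R) :
  measurable_fun [set: euclid R n] (fun x : euclid R n => meval x P).
Proof.
under eq_fun do rewrite mevalE.
apply: measurable_sum => m; apply: measurable_funM => //.
by apply: measurable_prod => i _; apply: measurable_funX; exact: measurable_coord.
Qed.

Lemma measurable_semialg n (A : set ('I_n -> R)) : semialg A ->
  measurable (A : set (euclid R n)).
Proof.
move=> [LL [_ ->]]; elim: LL => [|L LL ih].
  by rewrite (_ : (fun _ => _) = set0) //; apply/seteqP; split => x // [].
rewrite (_ : (fun _ => _) = (basic_set L : set (euclid R n)) `|`
    (fun x => exists2 L, List.In L LL & basic_set L x)); last first.
  apply/seteqP; split => x /=.
    by move=> [M [<-|iM] Mx]; [left|right; exists M].
  by move=> [Lx|[M iM Mx]]; [exists L => //; left|exists M => //; right].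
apply: measurableU => //; elim: L {LL ih} => [|[P b] L ih].
  rewrite (_ : basic_set _ = setT); first exact: measurableT.
  by apply/seteqP; split => x // _ c [].
rewrite (_ : basic_set _ = [set x | if b then 0 < meval x P else 0 <= meval x P]
    `&` (basic_set L : set (euclid R n))); last first.
  apply/seteqP; split => x /=.
    by move=> PLx; split; [apply: (PLx (P, b)); left|move=> c ic; apply: PLx; right].
  by move=> [Px Lx] c /= [<-|/Lx].
apply: measurableI => //.
rewrite (_ : mkset _ = (fun x : euclid R n => meval x P) @^-1`
    (if b then `]0, +oo[ else `[0, +oo[)).
  rewrite -[X in measurable X]setTI; apply: measurable_meval => //.
  by case: b.
by apply/seteqP; split => x; case: b; rewrite /= in_itv /= andbT.
Qed.

End Semialgebraic.

(** * Coordinate maps on semialgebraic sets, and disjoint packing in dimension at least 2 *)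

Section Closure.
Local Open Scope classical_set_scope.
Variable R : realType.
Implicit Types n : nat.
Local Notation var i := (mpolyX R (mnm1 i)).

Lemma semialg_last_gt0 n : semialg [set x : 'I_n.+1 -> R | 0 < x ord_max].
Proof.
have := semialg_gt0 (@alg_coef_var R n.+1 ord_max).
by congr semialg; apply/funext => x; rewrite /= mevalXU.
Qed.

Lemma semialg_affine n (a b : R) (A : set ('I_n.+1 -> R)) :
  algebraic a -> algebraic b -> semialg A -> semialg (affine_last a b @^-1` A).
Proof.
move=> aa ab sA; pose f (i : 'I_n.+1) := if unlift ord_max i is Some _ then var i
  else mpolyC n.+1 a * var i + mpolyC n.+1 b.
have af i : alg_coef_poly (f i).
  rewrite /f; case: unlift => [_|]; first exact: alg_coef_var.
  apply: alg_coefD; last exact: alg_coef_const.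
  by apply: alg_coefM; [exact: alg_coef_const|exact: alg_coef_var].
have := semialg_preimage af sA; congr semialg; apply/funext => x /=; congr A.
apply/funext => i; rewrite /affine_last /ext_pt /f; case: unliftP => [j|] ->.
  by rewrite mevalXU.
by rewrite mevalD mevalM !mevalC mevalXU.
Qed.

Lemma semialg_swap n (A : set ('I_n.+2 -> R)) :
  semialg A -> semialg (@swap_last R n @^-1` A).
Proof.
move=> sA; pose f (i : 'I_n.+2) := if unlift ord_max i is Some j then
    (if unlift ord_max j is Some _ then var i else var ord_max)
  else var (lift ord_max ord_max).
have af i : alg_coef_poly (f i).
  rewrite /f; case: unlift => [j|]; last exact: alg_coef_var.
  by case: unlift => *; exact: alg_coef_var.
have := semialg_preimage af sA; congr semialg; apply/funext => x /=; congr A.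
apply/funext => i; rewrite /swap_last /ext_pt /f; case: unliftP => [j ->|_]; last first.
  by rewrite mevalXU.
by case: unliftP => [k ->|_]; rewrite mevalXU.
Qed.

Lemma semialg_shear n (A : set ('I_n.+2 -> R)) :
  semialg A -> semialg (@shear_last R n @^-1` A).
Proof.
move=> sA; pose f (i : 'I_n.+2) := if unlift ord_max i is Some j then
    (if unlift ord_max j is Some _ then var i else var i - var ord_max)
  else var ord_max.
have af i : alg_coef_poly (f i).
  rewrite /f; case: unlift => [j|]; last exact: alg_coef_var.
  case: unlift => *; first exact: alg_coef_var.
  by apply: alg_coefB; exact: alg_coef_var.
have := semialg_preimage af sA; congr semialg; apply/funext => x /=; congr A.
apply/funext => i; rewrite /shear_last /ext_pt /f; case: unliftP => [j ->|_]; last first.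
  by rewrite mevalXU.
by case: unliftP => [k|] ->; rewrite ?mevalB !mevalXU.
Qed.

Lemma semialg_init n (A : set ('I_n -> R)) :
  semialg A -> semialg [set x : 'I_n.+1 -> R | A (init_pt x)].
Proof.
move=> sA; have af i : alg_coef_poly (var (lift (@ord_max n) i)).
  exact: alg_coef_var.
have := semialg_preimage af sA; congr semialg; apply/funext => x /=; congr A.
by apply/funext => i; rewrite mevalXU.
Qed.

(** The slice at t is [A] when t is in [D] and empty otherwise, so a constant is integrated over
    [D]. *)
Lemma vol_slab n (A : set (euclid R n)) (D : set R) : measurable D ->
  vol [set x : 'I_n.+1 -> R | A (init_pt x) /\ D (x ord_max)] =
  (vol A * @lebesgue_measure R D)%E.
Proof.
move=> mD; rewrite volS -(integral_cst (@lebesgue_measure R) mD) [RHS]integral_mkcond.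
apply: eq_integral => t _; rewrite patchE; case: ifPn => [/set_mem Dt|/negP Dt].
  congr vol; apply/funext => y; apply/propext => /=.
  by rewrite init_ext_pt ext_pt_max; split=> [[]|].
rewrite (_ : [set y | _] = set0) -?volumeE ?measure0 //.
apply/seteqP; split => // y [_]; rewrite ext_pt_max => ?.
by apply: Dt; rewrite mem_set.
Qed.

Lemma vol_point : vol [set: 'I_0 -> R] = 1%E.
Proof. by rewrite /=; case: asboolP. Qed.

Section Stacking.
Variable n : nat.
Implicit Types A B : set (euclid R n.+2).

(** Closed at y = 0 but open at t = 0: the two sheared copies are then 0 < t <= y and 0 <= y < t,
    and the diagonal belongs to only one of them. *)
Definition quadrant : set (euclid R n.+2) :=
  [set x | 0 <= init_pt x ord_max /\ 0 < x ord_max].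

(* The shears (y, t) -> (y + t, t) and (y, t) -> (y, y + t) map the quadrant
   onto the two halves of itself cut out by the diagonal. *)
Lemma quadrant_stack A B : semialg A -> semialg B ->
  A `<=` quadrant -> B `<=` quadrant ->
  exists C, [/\ semialg C, C `<=` quadrant & vol C = (vol A + vol B)%E].
Proof.
move=> sA sB AQ BQ.
pose A' := @shear_last R n @^-1` A.
(* Conjugating the shear by the swap yields (y, t) -> (y, t - y), whose preimage adds y to t. *)
pose B' := @swap_last R n @^-1` (@shear_last R n @^-1` (@swap_last R n @^-1` B)).
have sA' : semialg A' by exact: semialg_shear.
have sB1 := semialg_swap sB; have sB2 := semialg_shear sB1.
have sB' : semialg B' := semialg_swap sB2.
have A'E x : A' x -> 0 < x ord_max /\ x ord_max <= init_pt x ord_max.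
  move=> /AQ; rewrite /quadrant /= /shear_last init_ext_pt !ext_pt_max.
  by rewrite subr_ge0 => -[].
have B'E x : B' x -> 0 <= init_pt x ord_max /\ init_pt x ord_max < x ord_max.
  move=> /BQ; rewrite /quadrant /= /shear_last /swap_last.
  by rewrite !(init_ext_pt, ext_pt_max) subr_gt0.
exists (A' `|` B'); split; first exact: semialgU.
- move=> x [/A'E[t0 ty]|/B'E[y0 yt]]; rewrite /quadrant /=; split => //.
    by rewrite (le_trans (ltW t0)).
  by rewrite (le_lt_trans y0).
- have mA := measurable_semialg sA; have mB := measurable_semialg sB.
  rewrite volU; [|exact: measurable_semialg..|].
  + rewrite (vol_shear mA) (vol_swap (measurable_semialg sB2)).
    by rewrite (vol_shear (measurable_semialg sB1)) (vol_swap mB).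
  + apply/seteqP; split => x // [/A'E[_ ty] /B'E[_ yt]].
    by move: (le_lt_trans ty yt); rewrite ltxx.
Qed.

Definition reflect_y (x : euclid R n.+2) : euclid R n.+2 :=
  swap_last (affine_last (-1) 0 (swap_last x)).

Lemma semialg_reflect_y A : semialg A -> semialg (reflect_y @^-1` A).
Proof.
move=> sA; apply: (semialg_swap (A := affine_last (-1) 0 @^-1` (@swap_last R n @^-1` A))).
by apply: semialg_affine; [exact: algN1|exact: alg0|exact: semialg_swap].
Qed.

Lemma vol_reflect m (b : R) (A : set (euclid R m.+1)) : measurable A ->
  vol (affine_last (-1) b @^-1` A) = vol A.
Proof.
by move=> mA; rewrite [RHS](vol_affine b (a := -1)) ?normrN1 ?mul1e // oppr_eq0 oner_eq0.
Qed.

Lemma vol_reflect_y A : semialg A -> vol (reflect_y @^-1` A) = vol A.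
Proof.
move=> sA.
have s1 := semialg_swap sA.
have s2 := semialg_affine (algN1 R) (alg0 R) s1.
rewrite -(vol_swap (measurable_semialg sA)) -(vol_reflect 0 (measurable_semialg s1)).
by rewrite -(vol_swap (measurable_semialg s2)).
Qed.

Lemma semialg_y_ge0 : semialg [set x : euclid R n.+2 | 0 <= init_pt x ord_max].
Proof.
have := semialg_ge0 (@alg_coef_var R n.+2 (lift ord_max ord_max)).
by congr semialg; apply/funext => x; rewrite /= mevalXU.
Qed.

Lemma semialg_y_lt0 : semialg (~` [set x : euclid R n.+2 | 0 <= init_pt x ord_max]).
Proof.
have := semialg_gt0 (alg_coefN (@alg_coef_var R n.+2 (lift ord_max ord_max))).
congr semialg; apply/funext => x; rewrite /= mevalN mevalXU oppr_gt0.
by apply/propext; split => [|/negP]; rewrite ltNge // => /negP.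
Qed.

Lemma semialg_t_le0 : semialg (~` [set x : euclid R n.+2 | 0 < x ord_max]).
Proof.
have := semialg_ge0 (alg_coefN (@alg_coef_var R n.+2 ord_max)).
congr semialg; apply/funext => x; rewrite /= mevalN mevalXU oppr_ge0.
by apply/propext; split => [|/negP]; rewrite leNgt // => /negP.
Qed.

(** Cut along y = 0, reflect the part with y < 0 into the quadrant, and stack it with the other
    part. *)
Lemma fold_half_space A : semialg A -> A `<=` [set x | 0 < x ord_max] ->
  exists C, [/\ semialg C, C `<=` quadrant & vol C = vol A].
Proof.
move=> sA A0.
have s1 := semialgI sA semialg_y_ge0; have s2 := semialgI sA semialg_y_lt0.
have [||C [sC CQ vC]] := quadrant_stack s1 (semialg_reflect_y s2).
- by move=> x [/A0 t0 y0].
- move=> x [/A0 /= t0]; move: t0; rewrite /reflect_y /swap_last /affine_last /quadrant /=.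
  rewrite !(init_ext_pt, ext_pt_max) => t0 /negP; rewrite -ltNge mulN1r addr0 oppr_lt0.
  by move=> /ltW.
- exists C; split; [exact: sC|exact: CQ|].
  rewrite vC (vol_reflect_y s2); apply/esym/vol_split.
  + exact: measurable_semialg semialg_y_ge0.
  + exact: measurable_semialg.
Qed.

(** Cut along t = 0, bring both parts into the half-space t > 0, fold each one and stack the
    results. *)
Lemma fold_to_quadrant A : semialg A ->
  exists C, [/\ semialg C, C `<=` quadrant & vol C = vol A].
Proof.
move=> sA.
have s1 := semialgI sA (semialg_last_gt0 n.+1); have s2 := semialgI sA semialg_t_le0.
have [|C1 [sC1 C1Q vC1]] := fold_half_space s1; first by move=> x [].
(* The reflection t -> 1 - t sends t <= 0 to t >= 1; t -> -t would leave the points with t = 0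
   outside the open half-space. *)
have [|C2 [sC2 C2Q vC2]] := fold_half_space (semialg_affine (algN1 R) (alg1 R) s2).
  move=> x [_ /negP]; rewrite /= /affine_last ext_pt_max -leNgt mulN1r.
  by rewrite addrC subr_le0; apply: lt_le_trans.
have [C [sC CQ vC]] := quadrant_stack sC1 sC2 C1Q C2Q.
exists C; split; [exact: sC|exact: CQ|].
rewrite vC vC1 vC2 (vol_reflect _ (measurable_semialg s2)).
apply/esym/vol_split; first exact: measurable_semialg (semialg_last_gt0 _).
exact: measurable_semialg.
Qed.

Lemma vol_sum_ge2 A B : semialg A -> semialg B ->
  exists2 C : set (euclid R n.+2), semialg C & vol C = (vol A + vol B)%E.
Proof.
move=> /fold_to_quadrant[A' [sA' A'Q <-]] /fold_to_quadrant[B' [sB' B'Q <-]].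
by have [C [sC _ vC]] := quadrant_stack sA' sB' A'Q B'Q; exists C.
Qed.

End Stacking.

End Closure.

(** * Dimension 1: boundedness and packing by translation *)

Section Line.
Local Open Scope classical_set_scope.
Variable R : realType.

(** [P] has a constant truth value near +oo. This weak form of o-minimality is stable under Boolean
    operations and suffices to bound sets of finite length. *)
Definition eventually_decided (P : R -> Prop) : Prop :=
  exists M, (forall t, M <= t -> P t) \/ (forall t, M <= t -> ~ P t).

Lemma eventually_decidedU (P Q : R -> Prop) : eventually_decided P ->
  eventually_decided Q -> eventually_decided (fun t => P t \/ Q t).
Proof.
move=> [M [hP|hP]] [N hQ]; first by exists M; left => t /hP; left.
case: hQ => hQ; first by exists N; left => t /hQ; right.
by exists (Num.max M N); right => t; rewrite ge_max => /andP[/hP ? /hQ ?] [].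
Qed.

Lemma eventually_decidedI (P Q : R -> Prop) : eventually_decided P ->
  eventually_decided Q -> eventually_decided (fun t => P t /\ Q t).
Proof.
move=> [M [hP|hP]] [N hQ]; last by exists M; right => t /hP ? [].
case: hQ => hQ; last by exists N; right => t /hQ ? [].
by exists (Num.max M N); left => t; rewrite ge_max => /andP[/hP ? /hQ ?].
Qed.

(** Far to the right, a nonzero polynomial has the sign of its leading coefficient. *)
Lemma poly_eventually_decided (q : {poly R}) (b : bool) :
  eventually_decided (fun t => if b then 0 < q.[t] else 0 <= q.[t]).
Proof.
have [lq|lq|lq] := ltgtP 0 (lead_coef q).
- have [M hM] := polyrcf.poly_pinfty_gt_lc lq; exists M; left => t /hM qt.
  have qt0 := lt_le_trans lq qt.
  by case: b => //; exact: ltW.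
- have lq' : 0 < lead_coef (- q) by rewrite lead_coefN oppr_gt0.
  have [M hM] := polyrcf.poly_pinfty_gt_lc lq'; exists M; right => t /hM qt.
  have := lt_le_trans lq' qt; rewrite hornerN oppr_gt0 => qt0.
  by case: b; apply/negP; rewrite -?leNgt -?ltNge // ltW.
- move/esym/eqP: lq; rewrite lead_coef_eq0 => /eqP ->; exists 0.
  by case: b; [right|left] => t _; rewrite horner0 ?ltxx.
Qed.

(** For n = 1 the diagonal is the whole line, and this reads [P] as a univariate polynomial. *)
Lemma meval_diagonal n (P : mpoly n R) :
  exists q : {poly R}, forall t, meval (fun=> t) P = q.[t].
Proof.
exists (\sum_(m <- msupp P) (mcoeff m P)%:P * \prod_(i < n) 'X^(m i)) => t.
rewrite mevalE horner_sum; apply: eq_bigr => m _.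
rewrite hornerM hornerC horner_prod; congr (_ * _).
by apply: eq_bigr => i _; rewrite hornerXn.
Qed.

Lemma semialg_eventually_decided n (A : set ('I_n -> R)) : semialg A ->
  eventually_decided (fun t => A (fun=> t)).
Proof.
move=> [LL [_ ->]]; elim: LL => [|L LL ih].
  by exists 0; right => t _ [].
have : eventually_decided (fun t => basic_set L (fun=> t)).
  elim: L {LL ih} => [|[P b] L ih]; first by exists 0; left => t _ c [].
  have [q qE] := meval_diagonal P.
  have := eventually_decidedI (poly_eventually_decided q b) ih.
  congr eventually_decided; apply/funext => t; rewrite -qE; apply/propext; split.
    by move=> [Pt Lt] c /= [<-|/Lt].
  by move=> PLt; split; [apply: (PLt (P, b)); left|move=> c ic; apply: PLt; right].
move=> /eventually_decidedU/(_ ih); congr eventually_decided; apply/funext => t.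
apply/propext; split.
  by move=> [Lt|[M iM Mt]]; [exists L => //; left|exists M => //; right].
by move=> [M [<-|iM] Mt]; [left|right; exists M].
Qed.

Lemma point1E (x : 'I_1 -> R) : x = fun=> x ord_max.
Proof. by apply/funext => i; rewrite ord1; congr x; apply/val_inj. Qed.

Lemma vol_halfline (M : R) : vol [set x : 'I_1 -> R | M <= x ord_max] = +oo%E.
Proof.
rewrite (_ : [set x | _] =
    [set x | [set: 'I_0 -> R] (init_pt x) /\ [set` `[M, +oo[%R] (x ord_max)]).
  rewrite vol_slab; last exact: measurable_itv.
  by rewrite vol_point mul1e lebesgue_measure_itv /= ltry addye.
by apply/seteqP; split => x; rewrite /= in_itv /= andbT // => -[].
Qed.

Lemma le_vol n (A B : set (euclid R n)) : measurable A -> measurable B ->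
  A `<=` B -> (vol A <= vol B)%E.
Proof. by move=> mA mB AB; rewrite -!volumeE le_measure ?inE. Qed.

(** Near +oo the set contains either every point or none; the former would give it a half-line of
    infinite length. *)
Lemma semialg1_ubound (A : set ('I_1 -> R)) : semialg A -> (vol A < +oo)%E ->
  exists M, forall x, A x -> x ord_max < M.
Proof.
move=> sA; have [M [hM|hM] fA] := semialg_eventually_decided sA.
  move: fA; rewrite ltNge -(vol_halfline M) le_vol //.
  - have := @measurable_coord R 1 ord_max measurableT _ (measurable_itv `[M, +oo[%R).
    rewrite setTI; congr measurable; apply/seteqP.
    by split => x; rewrite /= in_itv /= andbT.
  - exact: measurable_semialg.
  - by move=> x /hM; rewrite -point1E.
exists M => x; rewrite [x in A x]point1E => Ax; rewrite ltNge; apply/negP => /hM.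
exact.
Qed.

Lemma vol_sum1 (A B : set ('I_1 -> R)) : semialg A -> semialg B ->
  (vol A < +oo)%E -> (vol B < +oo)%E ->
  exists2 C : set ('I_1 -> R), semialg C & vol C = (vol A + vol B)%E.
Proof.
move=> sA sB fA fB; have [M hM] := semialg1_ubound sA fA.
have sBN := semialg_affine (algN1 R) (alg0 R) sB.
have [|N hN] := semialg1_ubound sBN.
  by rewrite (vol_reflect _ (measurable_semialg sB)).
(* [A] lies below M and [B] above -N, so translating [B] by c > M + N puts it beyond [A]. A natural
   number is chosen to keep the translation algebraic. *)
pose c : R := (Num.bound `|M + N|)%:R.
have cMN : M + N < c.
  by apply: le_lt_trans (ler_norm _) _; apply: archi_boundP.
have sB' := semialg_affine (alg1 R) (algN (alg_nat R (Num.bound `|M + N|))) sB.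
exists (A `|` affine_last 1 (- c) @^-1` B); first exact: semialgU.
rewrite (volU (measurable_semialg sA) (measurable_semialg sB')).
  rewrite [X in (_ + X)%E = _](_ : _ = vol B) //.
  by rewrite [RHS](vol_affine (- c) (oner_neq0 R) (measurable_semialg sB)) normr1 mul1e.
apply/seteqP; split => x // [/hM xM Bx].
(* The reflection of c - x is x - c, a point of [B]; hence c - x < N, which contradicts x < M and M
   + N < c. *)
have := hN (affine_last (-1) c x).
rewrite /= /affine_last !(ext_pt_max, init_ext_pt) addr0 !mulN1r opprD opprK.
move: Bx; rewrite /= /affine_last mul1r => Bx /(_ Bx).
lra.
Qed.

End Line.

(** * The spaces V_n of differences of volumes *)

Section SemialgebraicVolumes.
Local Open Scope classical_set_scope.
Variable R : realType.
Implicit Types (n : nat) (u v a : R).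

Definition semialg_vol n u : Prop :=
  exists2 A : set ('I_n -> R), semialg A & vol A = u%:E.

Lemma period_in_dimP n a : period_in_dim n a <->
  exists u v, [/\ semialg_vol n u, semialg_vol n v & a = u - v].
Proof.
split=> [[A [B [/admissibleE[sA fA] [/admissibleE[sB fB]]]]]|].
  have vA : vol A = (fine (vol A))%:E by rewrite fineK // ge0_fin_numE // vol_ge0.
  have vB : vol B = (fine (vol B))%:E by rewrite fineK // ge0_fin_numE // vol_ge0.
  rewrite {1}vA {1}vB -EFinB => -[<-].
  by exists (fine (vol A)), (fine (vol B)); split => //; [exists A|exists B].
move=> [u [v [[A sA vA] [B sB vB] ->]]]; exists A, B; split.
  by apply/admissibleE; split => //; rewrite vA ltry.
by split; [apply/admissibleE; split => //; rewrite vB ltry|rewrite vA vB].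
Qed.

Lemma semialg_vol0 n : semialg_vol n 0.
Proof.
exists set0; first exact: semialg0.
by rewrite -volumeE measure0.
Qed.

Lemma semialg_volD n u v : semialg_vol n.+1 u -> semialg_vol n.+1 v ->
  semialg_vol n.+1 (u + v).
Proof.
move=> [A sA vA] [B sB vB].
suff [C sC vC] : exists2 C : set ('I_n.+1 -> R), semialg C & vol C = (vol A + vol B)%E.
  by exists C => //; rewrite vC vA vB.
case: n A sA vA B sB vB => [|n] A sA vA B sB vB; last exact: vol_sum_ge2.
by apply: vol_sum1; rewrite ?vA ?vB ?ltry.
Qed.

(** Multiply the set by the interval [0, a]. The case a = 1 raises the dimension and keeps the
    volume. *)
Lemma semialg_vol_slab n a u : algebraic a -> 0 <= a -> semialg_vol n u ->
  semialg_vol n.+1 (u * a).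
Proof.
move=> aa a0 [A sA vA].
exists [set x : 'I_n.+1 -> R | A (init_pt x) /\ [set` `[0, a]%R] (x ord_max)].
  have s1 := semialg_ge0 (@alg_coef_var R n.+1 ord_max).
  have s2 := semialg_ge0
    (alg_coefB (@alg_coef_const R n.+1 _ aa) (@alg_coef_var R n.+1 ord_max)).
  have := semialgI (semialg_init sA) (semialgI s1 s2).
  congr semialg; apply/seteqP; split => x /=;
    rewrite in_itv /= mevalB mevalC !mevalXU subr_ge0.
    by move=> [? [-> ->]].
  by move=> [? /andP[-> ->]].
rewrite vol_slab; last exact: measurable_itv.
rewrite vA lebesgue_measure_itv /= lte_fin EFinM.
have [_|] := ltP 0 a; first by rewrite -EFinB subr0.
by move=> a0'; congr (_ * _)%E; apply/esym; rewrite (@le_anti _ _ a 0) ?a0 ?a0'.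
Qed.

(** Stretching the last coordinate alone multiplies the volume by a, not by a power of a. *)
Lemma semialg_vol_scale n a u : algebraic a -> 0 < a -> semialg_vol n.+1 u ->
  semialg_vol n.+1 (a * u).
Proof.
move=> aa a0 [A sA vA]; exists (affine_last a^-1 0 @^-1` A).
  by apply: semialg_affine => //; [exact: algV|exact: alg0].
have ai0 : a^-1 != 0 by rewrite invr_eq0 gt_eqF.
have := vol_affine 0 ai0 (measurable_semialg sA).
rewrite vA gtr0_norm ?invr_gt0 // EFinM => ->.
by rewrite muleA -EFinM divff ?mul1e // gt_eqF.
Qed.

Lemma period_in_dim0 n : period_in_dim n (0 : R).
Proof.
by apply/period_in_dimP; exists 0, 0; rewrite subr0; split => //; exact: semialg_vol0.
Qed.

Lemma period_in_dimN n a : period_in_dim n a -> period_in_dim n (- a).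
Proof.
move=> /period_in_dimP[u [v [su sv ->]]]; apply/period_in_dimP.
by exists v, u; rewrite opprB.
Qed.

Lemma period_in_dimD n a b : period_in_dim n.+1 a -> period_in_dim n.+1 b ->
  period_in_dim n.+1 (a + b).
Proof.
move=> /period_in_dimP[u [v [su sv ->]]] /period_in_dimP[w [z [sw sz ->]]].
apply/period_in_dimP; exists (u + w), (v + z); split; try exact: semialg_volD.
by rewrite opprD addrACA.
Qed.

(** Positive factors rescale both domains; a negative sign exchanges them. *)
Lemma period_in_dimZ n a b : algebraic a -> period_in_dim n.+1 b ->
  period_in_dim n.+1 (a * b).
Proof.
wlog a0 : a / 0 <= a => [hwlog aa pb|].
  have [a0|/ltW a0] := leP 0 a; first exact: hwlog.
  rewrite -[a]opprK mulNr; apply: period_in_dimN.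
  by apply: hwlog => //; [rewrite oppr_ge0|exact: algN].
move: a0; rewrite le_eqVlt => /predU1P[<- _ _|a0 aa].
  by rewrite mul0r; exact: period_in_dim0.
move=> /period_in_dimP[u [v [su sv ->]]]; apply/period_in_dimP.
by exists (a * u), (a * v); rewrite mulrBr; split => //; exact: semialg_vol_scale.
Qed.

Lemma period_in_dimS n a : period_in_dim n a -> period_in_dim n.+1 a.
Proof.
move=> /period_in_dimP[u [v [su sv ->]]]; apply/period_in_dimP; exists u, v.
by split=> //; rewrite -[X in semialg_vol _ X]mulr1;
   apply: semialg_vol_slab => //; exact: alg1.
Qed.

Lemma period_in_dim_le m n a : (m <= n)%N -> period_in_dim m a -> period_in_dim n a.
Proof.
move=> /subnKC <-; elim: (n - m)%N => [|k ih]; first by rewrite addn0.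
by rewrite addnS => /ih/period_in_dimS.
Qed.

Lemma semialg_vol_point : semialg_vol 0 (1 : R).
Proof.
exists setT; last exact: vol_point.
have := semialg_ge0 (@alg_coef_const R 0 _ (alg0 R)).
by congr semialg; apply/seteqP; split => x //=; rewrite mevalC.
Qed.

(** Write a as a times 1, where 1 is the length of the unit interval, a slab over the point R^0. *)
Lemma algebraic_period_in_dim n a : algebraic a -> period_in_dim n.+1 a.
Proof.
move=> aa; rewrite -[a]mulr1; apply: period_in_dimZ => //.
apply: (@period_in_dim_le 1) => //; apply/period_in_dimP; exists 1, 0.
split; last by rewrite subr0.
  rewrite -[X in semialg_vol _ X]mulr1.
  by apply: semialg_vol_slab => //; [exact: alg1|exact: semialg_vol_point].
exact: semialg_vol0.
Qed.

End SemialgebraicVolumes.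

(** * Complex periods, their degree and algebraic affine maps *)

Section AlgebraicComplex.
Import -(notations) complex.
Variable R : realType.
Implicit Types z : complex R.

(** Field morphisms are injective and fix the rational coefficients. This serves for the embedding
    of the reals and for conjugation. *)
Lemma algebraic_rmorph (F E : numFieldType) (f : {rmorphism F -> E}) (x : F) :
  algebraic (f x) <-> algebraic x.
Proof.
have fE (p : {poly rat}) : map_poly (@ratr E) p = map_poly f (map_poly (@ratr F) p).
  by rewrite -map_poly_comp; apply: eq_map_poly => r; rewrite /= fmorph_rat.
by split=> -[p [p0 px]]; exists p; move: px; rewrite fE fmorph_root.
Qed.

Lemma algebraic_Re z : algebraic z -> algebraic (Re z).
Proof.
move=> az; apply/(algebraic_rmorph (real_complex R)).
(* Re z is half the sum of z and its conjugate. *)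
rewrite /= ReJ_add; apply: algM; last by apply: algV; exact: alg_nat.
by apply: algD => //; apply/(algebraic_rmorph (@conjc R)).
Qed.

Lemma algebraic_imaginary : algebraic (Complex 0 1 : complex R).
Proof.
exists ('X^2 + 1); split.
  by rewrite -size_poly_eq0 size_polyDl ?size_polyXn ?size_poly1.
rewrite rmorphD /= map_polyXn rmorph1 rootE !hornerE.
by rewrite sqr_i addNr.
Qed.

Lemma algebraic_Im z : algebraic z -> algebraic (Im z).
Proof.
(* -Im z is the real part of z times the imaginary unit. *)
move=> az; rewrite -[Im z]opprK -ReiNIm.
by apply: algN; apply: algebraic_Re; apply: algM => //; exact: algebraic_imaginary.
Qed.

Definition complex_period_in_dim n z :=
  period_in_dim n (Re z) /\ period_in_dim n (Im z).

(** Both parts of a z + b are combinations of Re z, Im z and 1 with real algebraic coefficients. *)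
Lemma complex_period_in_dim_affine n (a b z : complex R) :
  algebraic a -> algebraic b -> complex_period_in_dim n.+1 z ->
  complex_period_in_dim n.+1 (a * z + b).
Proof.
move=> aa ab [pre pim]; have [ra ia] := (algebraic_Re aa, algebraic_Im aa).
have [rb ib] := (algebraic_Re ab, algebraic_Im ab).
have -> : a * z + b = Complex (Re a * Re z + - (Im a * Im z) + Re b)
    (Re a * Im z + Im a * Re z + Im b).
  by case: a b z {aa ab pre pim ra ia rb ib} => ? ? [? ?] [? ?].
split=> /=; apply: period_in_dimD; try exact: algebraic_period_in_dim;
  apply: period_in_dimD; try exact: period_in_dimZ.
by apply: period_in_dimN; exact: period_in_dimZ.
Qed.

(** Since V_n increases with n, the least dimension determines all the others. The convention deg(0)
    = 0 fits, as 0 lies in every V_n. *)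
Lemma real_degP (a : R) : real_period a -> exists2 d, real_deg a = Some d &
  (d == 0%N) = (a == 0) /\ forall n, (0 < n)%N -> period_in_dim n a <-> (d <= n)%N.
Proof.
move=> [m [m0 pm]]; rewrite /real_deg; case: eqP => [->|a0].
  by exists 0%N => //; split => // n _; split => // _; exact: period_in_dim0.
case: pselect => [H|[]]; last by exists m; apply/asboolP.
case: ex_minnP => d /asboolP[d0 pd] dmin; exists d => //; split.
  by apply/negbTE; rewrite -lt0n.
move=> n n0; split=> [pn|dn]; first by apply: dmin; apply/asboolP.
exact: period_in_dim_le pd.
Qed.

(** A maximum is at most n when both degrees are; it is positive because one of the two parts is
    nonzero. *)
Lemma degP z : period z -> z != 0 -> exists d, [/\ deg z = Some d, (0 < d)%N &
  forall n, (0 < n)%N -> complex_period_in_dim n z <-> (d <= n)%N].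
Proof.
move=> [/real_degP[r rE [r0 rP]] /real_degP[i iE [i0 iP]]] z0.
exists (maxn r i); rewrite /deg rE iE; split => //.
  rewrite lt0n -leqn0 geq_max !leqn0 r0 i0.
  by move: z0; case: z {rE rP iE iP r0 i0} => x y; rewrite eq_complex.
move=> n n0; rewrite geq_max; split=> [[/rP-> // /iP-> //]|/andP[rn i_n]].
by split; [apply/rP|apply/iP].
Qed.

Lemma algebraic_affine_deg z w (a b c d : complex R) :
  period z -> period w -> z != 0 -> w != 0 ->
  algebraic a -> algebraic b -> algebraic c -> algebraic d ->
  w = a * z + b -> z = c * w + d -> deg z = deg w.
Proof.
move=> pz pw z0 w0 aa ab ac ad wE zE.
have [k [-> k0 kP]] := degP pz z0; have [l [-> l0 lP]] := degP pw w0.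
congr Some; apply/eqP; rewrite eqn_leq; apply/andP; split.
  (* Place [w] in dimension deg w and carry it to [z] by the affine map. Positivity of the degree
     matters: the closure properties hold from dimension 1 on. *)
  apply/(kP _ l0); case: l l0 lP => // l _ /(_ l.+1 isT)[_ /(_ (leqnn _))].
  by rewrite zE; exact: complex_period_in_dim_affine.
apply/(lP _ k0); case: k k0 kP => // k _ /(_ k.+1 isT)[_ /(_ (leqnn _))].
by rewrite wE; exact: complex_period_in_dim_affine.
Qed.

Lemma transcendental_neq0 z : transcendental z -> z != 0.
Proof. by move=> tr; apply/eqP => z0; apply: tr; rewrite z0; exact: alg0. Qed.

Lemma transcendental_div_period z w : period z -> period w ->
  transcendental z -> transcendental w -> deg z <> deg w ->
  transcendental (z / w).
Proof.
move=> pz pw /transcendental_neq0 z0 /transcendental_neq0 w0 degzw azw.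
apply: degzw; set q := z / w in azw.
have q0 : q != 0 by rewrite mulf_neq0 ?invr_eq0.
(* With q = z / w algebraic and nonzero, w = z / q and z = q w. *)
apply: (algebraic_affine_deg (a := q^-1) (b := 0) (c := q) (d := 0)) => //.
- exact: algV.
- exact: alg0.
- exact: alg0.
- by rewrite addr0 invf_div divfK.
- by rewrite addr0 divfK.
Qed.

Lemma transcendental_add_period z w : period z -> period w ->
  transcendental z -> transcendental w -> deg z <> deg w ->
  transcendental (z + w).
Proof.
move=> pz pw /transcendental_neq0 z0 /transcendental_neq0 w0 degzw azw.
have aN1 := algN1 (complex R).
(* With s = z + w algebraic, w = -z + s and z = -w + s. *)
apply: degzw; apply: (algebraic_affine_deg pz pw z0 w0 aN1 azw aN1 azw).
- by rewrite mulN1r addKr.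
- by rewrite mulN1r addrC addrK.
Qed.

End AlgebraicComplex.

Theorem theorem5p2 (R : realType) (p1 p2 : complex.complex R) :
  period p1 -> period p2 ->
  transcendental p1 -> transcendental p2 ->
  deg p1 <> deg p2 ->
  transcendental (p1 / p2) /\ transcendental (p1 + p2).
Proof.
move=> per1 per2 tr1 tr2 deg12; split.
- exact: transcendental_div_period.
- exact: transcendental_add_period.
Qed.
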